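(* For operators $o_1,o_2$ among the $21$ operators $$c,\ c{-}{-},\ cic,\ cic{-}{-},\ ci,\ ic,\ ic{-}{-},\ ici,\ i,\ \mathsf{id},\ {-}{-},\qquad {-}i,\ {-},\ {-}ici,\ ci{-},\ {-}ci,\ {-}ic,\ ici{-},\ i{-},\ {-}cic,\ {-}c,$$ the inclusion $o_1(S)\subseteq o_2(S)$ holds for every locale $L$ and every sublocale $S\in\mathsf{S}(L)$ if and only if $o_1\le o_2$ belongs to the reflexive-transitive closure of the following relations (the edges of the Hasse diagram). First component: $i\le ici$; $ici\le ic{-}{-}$; $ic{-}{-}\le ic$; $ic\le cic$; $cic\le c$; $ici\le ci$; $ci\le cic{-}{-}$; $cic{-}{-}\le cic$; $ic{-}{-}\le cic{-}{-}$; $cic{-}{-}\le c{-}{-}$; $i\le {-}{-}$; ${-}{-}\le \mathsf{id}$; $\mathsf{id}\le c$; ${-}{-}\le c{-}{-}$; $c{-}{-}\le c$. Second component: ${-}c\le i{-}$; $i{-}\le {-}$; ${-}\le {-}i$; ${-}c\le {-}cic$; ${-}cic\le ici{-}$; $ici{-}\le {-}ci$; ${-}ci\le {-}ici$; ${-}ici\le {-}i$; $i{-}\le ici{-}$; $ici{-}\le ci{-}$; $ci{-}\le {-}ici$; ${-}cic\le {-}ic$; ${-}ic\le ci{-}$.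
   Context: A locale $L$ is a complete Heyting algebra. A sublocale of $L$ is a subset $S\subseteq L$ closed under arbitrary meets (in particular containing $\top$) and such that $a\rightarrow s\in S$ for all $a\in L$, $s\in S$. The set $\mathsf{S}(L)$ of sublocales, ordered by inclusion $\subseteq$, is a co-frame (its order dual is a frame); its least element is $\{\top\}$ and its greatest is $L$. For $a\in L$ the closed sublocale associated with $a$ is $\{x\in L: a\le x\}$ and the open sublocale associated with $a$ is $\{a\rightarrow x: x\in L\}$; these are complements of each other in $\mathsf{S}(L)$. For $S\in\mathsf{S}(L)$: $c(S)$ is the smallest closed sublocale containing $S$; $i(S)$ is the largest open sublocale contained in $S$; and ${-}S$ is the supplement (co-pseudocomplement) of $S$, i.e. the smallest $T\in\mathsf{S}(L)$ with $S\vee T=L$. $\mathsf{id}$ is the identity, and words denote compositions (e.g. $ic{-}{-}(S)=i(c({-}({-}S)))$). *)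

(* Defs.v *)
From HB Require Import structures.
From Stdlib Require Import Relation_Operators.
From mathcomp Require Import all_boot all_order.
From mathcomp Require Import boolp classical_sets.

Set Implicit Arguments.
Unset Strict Implicit.
Unset Printing Implicit Defensive.

Import Order.Theory.

Local Open Scope classical_set_scope.

(* A complete Heyting algebra. Only arbitrary meets are required: joins (and
   the frame distributivity law) follow from the existence of all meets and of
   the implication. *)
HB.mixin Record isLocale d L & Order.TBLattice d L := {
  himpl : L -> L -> L ;
  himplP : forall a b x : L,
    (x <= himpl a b)%O = (Order.meet x a <= b)%O ;
  bigmeet : set L -> L ;
  bigmeetP : forall A : set L, infimums A (bigmeet A)
}.

#[short(type="localeType")]
HB.structure Definition Locale d := { L of Order.TBLattice d L & isLocale d L }.

Section Sublocales.
Context {d : Order.disp_t} {L : localeType d}.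
Implicit Types (a b x y : L) (A : set L).

Definition is_sublocale (S : set L) : Prop :=
  (forall A, A `<=` S -> S (bigmeet A)) /\
  (forall a s, S s -> S (himpl a s)).

Lemma bigmeet_lb A x : A x -> (bigmeet A <= x)%O.
Proof. by case: (bigmeetP A) => + _; apply. Qed.

Lemma bigmeet_glb A y : (forall x, A x -> (y <= x)%O) -> (y <= bigmeet A)%O.
Proof. by case: (bigmeetP A) => _ + h; apply. Qed.

Lemma himpl_meet a x y :
  himpl a (Order.meet x y) = Order.meet (himpl a x) (himpl a y).
Proof.
apply/le_anti/andP; split.
  rewrite lexI !himplP; apply/andP; split.
    by rewrite (le_trans _ (leIl x y)) // -himplP.
  by rewrite (le_trans _ (leIr y x)) // -himplP.
rewrite himplP lexI; apply/andP; split; rewrite -himplP.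
  exact: leIl.
exact: leIr.
Qed.

Lemma himpl_curry a b x : himpl a (himpl b x) = himpl (Order.meet a b) x.
Proof.
apply/le_anti/andP; split.
  by rewrite himplP meetA -himplP -himplP.
by rewrite 2!himplP -meetA -himplP.
Qed.

Lemma himpl_bigmeet a A : himpl a (bigmeet A) = bigmeet (himpl a @` A).
Proof.
apply/le_anti/andP; split.
  apply: bigmeet_glb => _ [x Ax <-]; rewrite himplP.
  by apply: le_trans (bigmeet_lb Ax); rewrite -himplP.
rewrite himplP; apply: bigmeet_glb => x Ax; rewrite -himplP.
by apply: bigmeet_lb; exists x.
Qed.

Lemma le_himpl a x : (x <= himpl a x)%O.
Proof. by rewrite himplP leIl. Qed.

Lemma mp_himpl a x : (Order.meet (himpl a x) a <= x)%O.
Proof. by rewrite -himplP. Qed.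

End Sublocales.

Record sublocale d (L : localeType d) := Sublocale {
  sublocale_set :> set L ;
  sublocaleP : is_sublocale sublocale_set
}.

Section Operators.
Context {d : Order.disp_t} {L : localeType d}.
Implicit Types (a x : L) (S T : sublocale L) (F : set (sublocale L)).

Lemma sublocale_meet S x y :
  sublocale_set S x -> sublocale_set S y -> sublocale_set S (Order.meet x y).
Proof.
move=> Sx Sy.
have -> : Order.meet x y = bigmeet [set x; y].
  apply/le_anti/andP; split.
    by apply: bigmeet_glb => z [] ->; rewrite ?leIl ?leIr.
  by rewrite lexI !bigmeet_lb //; [right | left].
by apply: (sublocaleP S).1 => z [] ->.
Qed.

Lemma sl_inf_subproof F :
  is_sublocale (\bigcap_(T in F) (T : set L)).
Proof.
split=> [A sA T FT|a s hs T FT].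
  by apply: (sublocaleP T).1 => x /sA; apply.
by apply: (sublocaleP T).2; apply: hs.
Qed.
(* Infima and suprema in the complete lattice of sublocales: infima are
   intersections, suprema are not unions. *)
Definition sl_inf F : sublocale L := Sublocale (sl_inf_subproof F).
Definition sl_sup F : sublocale L :=
  sl_inf [set T : sublocale L | forall S, F S -> S `<=` T].
Definition sl_join S T : sublocale L := sl_sup [set S; T].

Lemma closed_subproof a : is_sublocale [set x | (a <= x)%O].
Proof.
split=> [A sA|b s /= as_]; first by apply: bigmeet_glb => x /sA.
exact: le_trans as_ (le_himpl b s).
Qed.
Definition closed_sl a : sublocale L := Sublocale (closed_subproof a).

Lemma open_subproof a : is_sublocale (range (himpl a)).
Proof.
split=> [A sA|b _ [x _ <-]].
  exists (bigmeet A) => //; rewrite himpl_bigmeet; congr bigmeet.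
  have imK x : A x -> himpl a x = x.
    by move=> /sA [y _ <-]; rewrite himpl_curry meetxx.
  apply/seteqP; split=> [_ [x Ax <-]|x Ax]; first by rewrite imK.
  by exists x => //; rewrite imK.
exists (himpl b x) => //; by rewrite !himpl_curry meetC.
Qed.
Definition open_sl a : sublocale L := Sublocale (open_subproof a).

Definition is_closed S : Prop := exists a, S = closed_sl a.
Definition is_open S : Prop := exists a, S = open_sl a.

Definition sl_closure S : sublocale L :=
  sl_inf [set T : sublocale L | is_closed T /\ S `<=` T].

Definition sl_interior S : sublocale L :=
  sl_sup [set T : sublocale L | is_open T /\ T `<=` S].

Definition sl_suppl S : sublocale L :=
  sl_inf [set T : sublocale L | sl_join S T = setT :> set L].

Lemma sublocale_eq S T : S = T :> set L -> S = T.
Proof.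
case: S T => [S pS] [T pT] /= e; case: _ / e pT => pT.
by congr Sublocale; apply: Prop_irrelevance.
Qed.

Lemma sl_joinE S T :
  sl_join S T = [set x | exists s t,
    [/\ sublocale_set S s, sublocale_set T t & x = Order.meet s t]] :> set L.
Proof.
apply/seteqP; split=> [x Jx|_ [s [t [Ss Tt ->]]] U hU]; last first.
  by apply: sublocale_meet; [apply: (hU S) => //; left | apply: (hU T) => //; right].
have slJ : is_sublocale
    [set x : L | exists s t,
      [/\ sublocale_set S s, sublocale_set T t & x = Order.meet s t]].
  split=> [A sA|a _ [s [t [Ss Tt ->]]]].
    exists (bigmeet [set s | sublocale_set S s /\ (bigmeet A <= s)%O]).
    exists (bigmeet [set t | sublocale_set T t /\ (bigmeet A <= t)%O]).
    split; [by apply: (sublocaleP S).1 => ? [] |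
            by apply: (sublocaleP T).1 => ? [] | ].
    apply/le_anti/andP; split.
      by rewrite lexI; apply/andP; split; apply: bigmeet_glb => ? [].
    apply: bigmeet_glb => y Ay; have [s [t [Ss Tt yE]]] := sA _ Ay.
    have Ay' := bigmeet_lb Ay.
    rewrite yE; apply: leI2; apply: bigmeet_lb; split=> //;
      by apply: (le_trans Ay'); rewrite yE ?leIl ?leIr.
  exists (himpl a s), (himpl a t); rewrite himpl_meet; split=> //.
    exact: (sublocaleP S).2.
  exact: (sublocaleP T).2.
have top0 : bigmeet set0 = \top%O :> L.
  by apply/le_anti/andP; split; [rewrite lex1 | apply: bigmeet_glb].
have sl1 (U : sublocale L) : sublocale_set U \top%O.
  by rewrite -top0; apply: (sublocaleP U).1.
apply: (Jx (Sublocale slJ)) => U [] -> u Uu /=.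
- by exists u, \top%O; split=> //; rewrite meetx1.
- by exists \top%O, u; split=> //; rewrite meet1x.
Qed.

Lemma sl_closureP S :
  [/\ is_closed (sl_closure S), S `<=` sl_closure S &
      forall T, is_closed T -> S `<=` T -> sl_closure S `<=` T].
Proof.
split; last by move=> T clT ST x; apply.
- exists (bigmeet S); apply: sublocale_eq.
  apply/seteqP; split=> x /=.
    move=> h; apply: (h (closed_sl (bigmeet S))); split; first by exists (bigmeet S).
    by move=> s /bigmeet_lb.
  move=> Sx _ [[a ->] sa] /=; apply: le_trans Sx.
  by apply: bigmeet_glb => s /sa.
- by move=> s Ss T [_]; apply.
Qed.

Lemma sl_interiorP S :
  [/\ is_open (sl_interior S), sl_interior S `<=` S &
      forall T, is_open T -> T `<=` S -> T `<=` sl_interior S].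
Proof.
split; last by move=> T opT TS x Tx U hU; apply: (hU T).
- pose B := [set a | open_sl a `<=` S].
  pose u := bigmeet [set y | forall a, B a -> (a <= y)%O].
  have Bu a : B a -> (a <= u)%O by move=> Ba; apply: bigmeet_glb => y; apply.
  have uP y : (forall a, B a -> (a <= y)%O) -> (u <= y)%O.
    by move=> h; apply: bigmeet_lb.
  exists u; apply: sublocale_eq; apply/seteqP; split=> x.
    apply=> _ [[a ->] aS] _ [y _ <-] /=.
    exists (himpl a y) => //; rewrite himpl_curry; congr himpl.
    by apply/meet_idPr; apply: Bu.
  move=> [y _ <-] U hU.
  have -> : himpl u y = bigmeet [set himpl a y | a in B].
    apply/le_anti/andP; split.
      apply: bigmeet_glb => _ [a Ba <-]; rewrite himplP.
      by apply: le_trans (mp_himpl u y); apply: leI2 => //; apply: Bu.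
    rewrite himplP meetC -himplP; apply: uP => a Ba.
    by rewrite himplP meetC -himplP; apply: bigmeet_lb; exists a.
  apply: (sublocaleP U).1 => _ [a Ba <-].
  apply: (hU (open_sl a)); last by exists y.
  by split=> //; exists a.
- by move=> x; apply=> T [_].
Qed.

Lemma sl_supplP S :
  sl_join S (sl_suppl S) = setT :> set L /\
  forall T, sl_join S T = setT :> set L -> sl_suppl S `<=` T.
Proof.
split; last by move=> T h x; apply.
rewrite sl_joinE; apply/seteqP; split=> // x _ /=.
pose s := bigmeet [set y | sublocale_set S y /\ (x <= y)%O].
have xs : (x <= s)%O by apply: bigmeet_glb => ? [].
exists s, (himpl s x); split.
- by apply: (sublocaleP S).1 => ? [].
- move=> T hT.
  have : sublocale_set (sl_join S T) x by rewrite [sublocale_set _]hT.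
  rewrite sl_joinE => -[s' [t [Ss' Tt xE]]].
  have ss' : (s <= s')%O by apply: bigmeet_lb; split=> //; rewrite xE leIl.
  suff -> : himpl s x = himpl s t by apply: (sublocaleP T).2.
  rewrite xE himpl_meet; apply/meet_idPr.
  by rewrite himplP; apply: le_trans ss'; apply: leIr.
- apply/le_anti/andP; split; first by rewrite lexI xs le_himpl.
  by rewrite meetC; apply: mp_himpl.
Qed.

End Operators.

(* In the names, the letter n stands for the supplement. *)
Inductive operator : Set :=
| o_c | o_cnn | o_cic | o_cicnn | o_ci | o_ic | o_icnn | o_ici | o_i | o_id | o_nn
| o_ni | o_n | o_nici | o_cin | o_nci | o_nic | o_icin | o_in | o_ncic | o_nc.

Definition interp (o : operator) {d} {L : localeType d} :
    sublocale L -> sublocale L :=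
  let C := @sl_closure d L in
  let I := @sl_interior d L in
  let N := @sl_suppl d L in
  match o with
  | o_c     => C
  | o_cnn   => C \o N \o N
  | o_cic   => C \o I \o C
  | o_cicnn => C \o I \o C \o N \o N
  | o_ci    => C \o I
  | o_ic    => I \o C
  | o_icnn  => I \o C \o N \o N
  | o_ici   => I \o C \o I
  | o_i     => I
  | o_id    => id
  | o_nn    => N \o N
  | o_ni    => N \o I
  | o_n     => N
  | o_nici  => N \o I \o C \o I
  | o_cin   => C \o I \o N
  | o_nci   => N \o C \o I
  | o_nic   => N \o I \o C
  | o_icin  => I \o C \o I \o N
  | o_in    => I \o N
  | o_ncic  => N \o C \o I \o C
  | o_nc    => N \o C
  end.

Definition hasse_edge (o1 o2 : operator) : Prop :=
  match o1, o2 with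
  | o_i, o_ici | o_ici, o_icnn | o_icnn, o_ic | o_ic, o_cic | o_cic, o_c
  | o_ici, o_ci | o_ci, o_cicnn | o_cicnn, o_cic | o_icnn, o_cicnn | o_cicnn, o_cnn
  | o_i, o_nn | o_nn, o_id | o_id, o_c | o_nn, o_cnn | o_cnn, o_c
  | o_nc, o_in | o_in, o_n | o_n, o_ni
  | o_nc, o_ncic | o_ncic, o_icin | o_icin, o_nci | o_nci, o_nici | o_nici, o_ni
  | o_in, o_icin | o_icin, o_cin | o_cin, o_nici
  | o_ncic, o_nic | o_nic, o_cin => True
  | _, _ => False
  end.

Definition hasse_le : operator -> operator -> Prop :=
  clos_refl_trans operator hasse_edge.

(* Main.v *)
(* The interior is [-c-], and closed and open sublocales are mutual supplements;
   with the monotonicity of [c] and [i], the antitonicity of [-], [cc = c] and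
   [--S <= S], this gives every edge of the diagram formally.

   For the converse, let [P] be a poset with its upsets as opens, and let [p_y]
   be the complement of the principal downset of [y], a prime element. A subset
   [Y] of [P] induces the sublocale of all meets of copoints [p_y], [y] in [Y];
   the closure of it is induced by the downset of [Y], and the supplement of any
   sublocale [S] is induced by [{y | p_y notin S}], so by [~Y] when [S] is
   induced by [Y]. Two posets suffice. In [nat] the double-negation sublocale
   [B] is dense with [-B] everything and [--B = {top}], whereas the even numbers
   induce a dense sublocale with empty interior that is fixed by [--]. The fork
   (two maximal points above a common bottom) separates the operators that
   already differ on complemented sublocales. *)

Require Import Defs.
From HB Require Import structures.
From Stdlib Require Import Relation_Operators.
From mathcomp Require Import all_boot all_order.
From mathcomp Require Import boolp classical_sets.

Local Open Scope classical_set_scope.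

Set Implicit Arguments.
Unset Strict Implicit.
Unset Printing Implicit Defensive.

Import Order.Theory.

(** * Formal calculus of closure, interior and supplement *)

Section OperatorCalculus.
Context {d : Order.disp_t} {L : localeType d}.
Implicit Types (a x : L) (S T : sublocale L).

Lemma sublocale_eqP S T : S `<=` T -> T `<=` S -> S = T.
Proof. by move=> ST TS; apply/sublocale_eq/seteqP. Qed.

Lemma sl_join_setT S T : (forall x, exists s t,
    [/\ sublocale_set S s, sublocale_set T t & x = Order.meet s t]) ->
  sl_join S T = setT :> set L.
Proof. by move=> h; rewrite sl_joinE; apply/seteqP; split=> // x _; exact: h. Qed.

Lemma sl_join_setTP S T x : sl_join S T = setT :> set L -> exists s t,
  [/\ sublocale_set S s, sublocale_set T t & x = Order.meet s t].
Proof.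
rewrite sl_joinE => /seteqP[_ /(_ x I)].
by move=> [s [t h]]; exists s, t.
Qed.

Lemma sl_suppl_anti S T : S `<=` T -> sl_suppl T `<=` sl_suppl S.
Proof.
move=> ST; apply: (sl_supplP T).2; apply: sl_join_setT => x.
have [s [t [/ST Ts St ->]]] := sl_join_setTP x (sl_supplP S).1.
by exists s, t.
Qed.

Lemma sl_suppl_suppl_sub S : sl_suppl (sl_suppl S) `<=` S.
Proof.
apply: (sl_supplP _).2; apply: sl_join_setT => x.
have [s [t [Ss St ->]]] := sl_join_setTP x (sl_supplP S).1.
by exists t, s; split=> //; rewrite meetC.
Qed.

Lemma sl_suppl3 S : sl_suppl (sl_suppl (sl_suppl S)) = sl_suppl S.
Proof.
apply: sublocale_eqP; first exact: sl_suppl_suppl_sub.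
exact/sl_suppl_anti/sl_suppl_suppl_sub.
Qed.

Lemma himpl_absorb a x : himpl a (himpl a x) = himpl a x.
Proof. by rewrite himpl_curry meetxx. Qed.

Lemma himpl_top a x : (a <= x)%O -> himpl a x = \top%O.
Proof. by move=> ax; apply/eqP; rewrite -le1x himplP meet1x. Qed.

(** Every [x] splits as the meet of [Order.join a x], in the closed part, and [himpl a x], in the
    open part. For minimality, [himpl a x] itself is split: [himpl a] fixes it and sends the closed
    factor to the top, which leaves [himpl a t] with [t] in [T]. *)
Lemma sl_suppl_closed a : sl_suppl (closed_sl a) = open_sl a.
Proof.
apply: sublocale_eqP.
  apply: (sl_supplP _).2; apply: sl_join_setT => x.
  exists (Order.join a x), (himpl a x); split; [exact: leUl | by exists x |].
  apply/le_anti/andP; split; first by rewrite lexI leUr le_himpl.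
  rewrite -himplP leUx; apply/andP; split; last exact: le_himpl.
  by rewrite himplP meetC mp_himpl.
move=> _ [x _ <-] T hT.
have [s [t [/= sa Tt xE]]] := sl_join_setTP (himpl a x) hT.
by rewrite -himpl_absorb xE himpl_meet (himpl_top sa) meet1x; apply: (sublocaleP T).2.
Qed.

Lemma sl_suppl_open a : sl_suppl (open_sl a) = closed_sl a.
Proof.
apply: sublocale_eqP.
  apply: (sl_supplP _).2; apply: sl_join_setT => x.
  have [s [t [Ss St ->]]] :=
    sl_join_setTP x (sl_supplP (closed_sl a)).1.
  rewrite sl_suppl_closed in St.
  by exists t, s; split=> //; rewrite meetC.
move=> x /= ax T hT.
have [_ [t [[y _ <-] Tt xE]]] := sl_join_setTP x hT.
(* From [a <= x <= himpl a y] follows [a <= y], so the open factor is the top and [x] equals the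
   factor in [T]. *)
have ay : (a <= y)%O.
  rewrite -(meetxx a) -himplP; apply: le_trans ax _.
  by rewrite xE leIl.
by rewrite xE (himpl_top ay) meet1x.
Qed.

Lemma sl_closureE S : sl_closure S = closed_sl (bigmeet S).
Proof.
have [[a aE] Sc cmin] := sl_closureP S.
apply: sublocale_eqP => [|x hx].
  by apply: cmin; [exists (bigmeet S) | move=> s /bigmeet_lb].
rewrite aE /=; apply: le_trans hx.
by apply: bigmeet_glb => s /Sc; rewrite aE.
Qed.

Lemma sub_sl_closure S : S `<=` sl_closure S.
Proof. by have [] := sl_closureP S. Qed.

Lemma sl_closure_mono S T : S `<=` T -> sl_closure S `<=` sl_closure T.
Proof.
have [_ _ cmin] := sl_closureP S; have [clT Tc _] := sl_closureP T.
by move=> ST; apply: cmin => // x /ST /Tc.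
Qed.

Lemma sl_closure_closed S : is_closed S -> sl_closure S = S.
Proof.
move=> clS; apply: sublocale_eqP; last exact: sub_sl_closure.
by have [_ _] := sl_closureP S; apply.
Qed.

Lemma sl_closureK S : sl_closure (sl_closure S) = sl_closure S.
Proof. by apply: sl_closure_closed; have [] := sl_closureP S. Qed.

Lemma sl_suppl2_closure S : sl_suppl (sl_suppl (sl_closure S)) = sl_closure S.
Proof. by rewrite sl_closureE sl_suppl_closed sl_suppl_open. Qed.

(** Supplements exchange open and closed sublocales, so the largest open sublocale inside [S]
    corresponds to the smallest closed one around [-S]; the inclusion of [--S] in [S] brings the
    result back inside [S]. *)
Lemma sl_interiorE S : sl_interior S = sl_suppl (sl_closure (sl_suppl S)).
Proof.
have [[u uE] uS imax] := sl_interiorP S.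
apply: sublocale_eqP.
  rewrite uE -sl_suppl_closed; apply: sl_suppl_anti.
  have [_ _] := sl_closureP (sl_suppl S); apply; first by exists u.
  by rewrite -sl_suppl_open; apply: sl_suppl_anti; rewrite -uE.
apply: imax.
  by rewrite sl_closureE sl_suppl_closed; exists (bigmeet (sl_suppl S)).
move=> x /(sl_suppl_anti (@sub_sl_closure _)); exact: sl_suppl_suppl_sub.
Qed.

Lemma sl_interior_sub S : sl_interior S `<=` S.
Proof. by have [] := sl_interiorP S. Qed.

Lemma sl_interior_mono S T : S `<=` T -> sl_interior S `<=` sl_interior T.
Proof.
by move=> ST; rewrite !sl_interiorE; apply/sl_suppl_anti/sl_closure_mono/sl_suppl_anti.
Qed.

Lemma sl_interiorK S : sl_interior (sl_interior S) = sl_interior S.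
Proof. by rewrite !sl_interiorE sl_suppl2_closure sl_closureK. Qed.

Lemma sl_suppl2_interior S : sl_suppl (sl_suppl (sl_interior S)) = sl_interior S.
Proof. by rewrite sl_interiorE sl_suppl3. Qed.

Lemma sl_interior_sub_suppl2 S : sl_interior S `<=` sl_suppl (sl_suppl S).
Proof. by rewrite sl_interiorE; apply/sl_suppl_anti/sub_sl_closure. Qed.

Lemma sl_suppl_interior S : sl_suppl (sl_interior S) = sl_closure (sl_suppl S).
Proof. by rewrite sl_interiorE sl_suppl2_closure. Qed.

(** * Inclusions and identities behind the edges of the diagram *)

Lemma sl_suppl_closure_sub S : sl_suppl (sl_closure S) `<=` sl_interior (sl_suppl S).
Proof.
by rewrite sl_interiorE; apply/sl_suppl_anti/sl_closure_mono/sl_suppl_suppl_sub.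
Qed.

Lemma sl_suppl_interior_closure S :
  sl_suppl (sl_interior (sl_closure S)) `<=` sl_closure (sl_interior (sl_suppl S)).
Proof. by rewrite sl_suppl_interior; apply/sl_closure_mono/sl_suppl_closure_sub. Qed.

Lemma sl_interior_suppl_closure S :
  sl_interior (sl_suppl (sl_closure S)) = sl_suppl (sl_closure S).
Proof. by rewrite sl_interiorE sl_suppl2_closure sl_closureK. Qed.

Lemma interior_sub_ici S :
  sl_interior S `<=` sl_interior (sl_closure (sl_interior S)).
Proof. by rewrite -{1}sl_interiorK; apply/sl_interior_mono/sub_sl_closure. Qed.

Lemma ici_sub_icnn S : sl_interior (sl_closure (sl_interior S)) `<=`
  sl_interior (sl_closure (sl_suppl (sl_suppl S))).
Proof. exact/sl_interior_mono/sl_closure_mono/sl_interior_sub_suppl2. Qed.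

Lemma cic_sub_c S : sl_closure (sl_interior (sl_closure S)) `<=` sl_closure S.
Proof. by move=> x /(sl_closure_mono (@sl_interior_sub _)); rewrite sl_closureK. Qed.

(** An interior is its own double supplement, so [-ci] equals [i-i]. By monotonicity of the interior
    it remains to place [ci-] below [-i], which is [c-]. *)
Lemma icin_sub_nci S : sl_interior (sl_closure (sl_interior (sl_suppl S))) `<=`
  sl_suppl (sl_closure (sl_interior S)).
Proof.
suff h : sl_closure (sl_interior (sl_suppl S)) `<=` sl_suppl (sl_interior S).
  rewrite -(sl_suppl2_interior S) -sl_interiorE; exact: sl_interior_mono.
rewrite sl_suppl_interior; exact/sl_closure_mono/sl_interior_sub.
Qed.

Lemma cin_sub_nici S : sl_closure (sl_interior (sl_suppl S)) `<=`
  sl_suppl (sl_interior (sl_closure (sl_interior S))).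
Proof.
rewrite sl_suppl_interior; apply: sl_closure_mono => x hx.
by apply/icin_sub_nci/interior_sub_ici.
Qed.

(** The left-hand side is its own interior, so it is enough to place it inside [ci-], and this goes
    through [-ic]. *)
Lemma ncic_sub_icin S : sl_suppl (sl_closure (sl_interior (sl_closure S))) `<=`
  sl_interior (sl_closure (sl_interior (sl_suppl S))).
Proof.
rewrite -sl_interior_suppl_closure; apply: sl_interior_mono => x hx.
apply: sl_suppl_interior_closure; move: x hx.
exact/sl_suppl_anti/sub_sl_closure.
Qed.

Lemma hasse_edge_sound o1 o2 S : hasse_edge o1 o2 -> interp o1 S `<=` interp o2 S.
Proof.
(* The 28 edges remain, sorted by source and then by target in the order of the constructors. *)
case: o1; case: o2; try (by case); move=> _; cbv beta iota zeta delta [interp comp].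
- exact/sl_closure_mono/sl_suppl_suppl_sub.
- exact: cic_sub_c.
- exact: cic_sub_c.
- exact/sl_closure_mono/sl_interior_mono/sl_closure_mono/sl_suppl_suppl_sub.
- by apply: sl_closure_mono => x /interior_sub_ici /ici_sub_icnn.
- exact: sub_sl_closure.
- exact: sub_sl_closure.
- exact/sl_interior_mono/sl_closure_mono/sl_suppl_suppl_sub.
- exact: sl_interior_sub.
- exact: ici_sub_icnn.
- exact: interior_sub_ici.
- exact: sl_interior_sub_suppl2.
- exact: sub_sl_closure.
- exact: sub_sl_closure.
- exact: sl_suppl_suppl_sub.
- exact/sl_suppl_anti/sl_interior_sub.
- exact/sl_suppl_anti/interior_sub_ici.
- exact: cin_sub_nici.
- exact/sl_suppl_anti/sl_interior_sub.
- exact: sl_suppl_interior_closure.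
- exact: sl_interior_sub.
- exact: icin_sub_nci.
- exact: sl_interior_sub.
- exact: interior_sub_ici.
- exact/sl_suppl_anti/sub_sl_closure.
- exact: ncic_sub_icin.
- exact: sl_suppl_closure_sub.
- exact/sl_suppl_anti/cic_sub_c.
Qed.

Lemma hasse_le_sound o1 o2 S : hasse_le o1 o2 -> interp o1 S `<=` interp o2 S.
Proof.
elim=> [x y|x u //|x y z _ xy _ yz u]; first exact: hasse_edge_sound.
by move=> /xy /yz.
Qed.

(* The table of [interp], with the interior computed as [-c-]. *)
Definition word (M : Type) (C N : M -> M) (o : operator) : M -> M :=
  let I := N \o C \o N in
  match o with
  | o_c     => C
  | o_cnn   => C \o N \o N
  | o_cic   => C \o I \o C
  | o_cicnn => C \o I \o C \o N \o N
  | o_ci    => C \o I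
  | o_ic    => I \o C
  | o_icnn  => I \o C \o N \o N
  | o_ici   => I \o C \o I
  | o_i     => I
  | o_id    => id
  | o_nn    => N \o N
  | o_ni    => N \o I
  | o_n     => N
  | o_nici  => N \o I \o C \o I
  | o_cin   => C \o I \o N
  | o_nci   => N \o C \o I
  | o_nic   => N \o I \o C
  | o_icin  => I \o C \o I \o N
  | o_in    => I \o N
  | o_ncic  => N \o C \o I \o C
  | o_nc    => N \o C
  end.

(** Once a family [r] of sublocales is stable under closure and supplement, all operators can be
    evaluated on its codes by mere computation. *)
Lemma interp_word M (C N : M -> M) (r : M -> sublocale L) o m :
  (forall m, sl_closure (r m) = r (C m)) ->
  (forall m, sl_suppl (r m) = r (N m)) ->
  interp o (r m) = r (word C N o m).
Proof.
move=> rC rN; case: o; cbv beta iota zeta delta [interp word comp];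
  by rewrite ?sl_interiorE ?(rN, rC).
Qed.

End OperatorCalculus.

(** * The locale of upsets of a poset *)

Record upset (d : Order.disp_t) (P : porderType d) := Upset {
  upset_set :> P -> Prop;
  upsetP : forall x y, (x <= y)%O -> upset_set x -> upset_set y
}.

Fact upset_display : Order.disp_t. Proof. exact: Order.Disp tt tt. Qed.

Section UpsetLocale.
Context {d : Order.disp_t} {P : porderType d}.
Implicit Types (U V W : upset P) (x y : P).

HB.instance Definition _ := gen_eqMixin (upset P).
HB.instance Definition _ := gen_choiceMixin (upset P).

Lemma upset_eq U V : upset_set U = upset_set V -> U = V.
Proof.
case: U V => [U pU] [V pV] /= e; case: _ / e pV => pV.
by congr Upset; apply: Prop_irrelevance.
Qed.

Definition up_le U V : bool := `[< upset_set U `<=` upset_set V >].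

Lemma up_leP U V : reflect (upset_set U `<=` upset_set V) (up_le U V).
Proof. exact: asboolP. Qed.

Lemma up_le_refl : reflexive up_le.
Proof. by move=> U; apply/up_leP. Qed.

Lemma up_le_anti : antisymmetric up_le.
Proof. by move=> U V /andP[/up_leP UV /up_leP VU]; apply/upset_eq/seteqP. Qed.

Lemma up_le_trans : transitive up_le.
Proof. by move=> V U W /up_leP UV /up_leP VW; apply/up_leP => x /UV /VW. Qed.

HB.instance Definition _ := Order.Le_isPOrder.Build upset_display (upset P)
  up_le_refl up_le_anti up_le_trans.

Lemma upset_leP U V : reflect (upset_set U `<=` upset_set V) (U <= V)%O.
Proof. exact: up_leP. Qed.

Definition up_meet U V : upset P := @Upset _ P (upset_set U `&` upset_set V)
  (fun x y xy Ux => conj (upsetP xy Ux.1) (upsetP xy Ux.2)).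

Lemma up_join_subproof U V x y : (x <= y)%O ->
  (upset_set U `|` upset_set V) x -> (upset_set U `|` upset_set V) y.
Proof. by move=> xy [] Ux; [left|right]; apply: upsetP Ux. Qed.
Definition up_join U V : upset P := Upset (@up_join_subproof U V).

Lemma up_meetP U V W : (U <= up_meet V W)%O = (U <= V)%O && (U <= W)%O.
Proof.
apply/upset_leP/andP => [h|[/upset_leP h1 /upset_leP h2] x Ux].
  by split; apply/upset_leP => x /h [].
by split; [apply: h1 | apply: h2].
Qed.

Lemma up_joinP U V W : (up_join U V <= W)%O = (U <= W)%O && (V <= W)%O.
Proof.
apply/upset_leP/andP => [h|[/upset_leP h1 /upset_leP h2] x [/h1|/h2] //].
by split; apply/upset_leP => x hx; apply: h; [left|right].
Qed.

HB.instance Definition _ :=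
  Order.POrder_MeetJoin_isLattice.Build upset_display (upset P)
    up_meetP up_joinP.

Definition up_bot : upset P := @Upset _ P set0 (fun _ _ _ h => h).
Definition up_top : upset P := @Upset _ P setT (fun _ _ _ h => h).

Lemma up_le0x U : (up_bot <= U)%O.
Proof. exact/upset_leP. Qed.

Lemma up_lex1 U : (U <= up_top)%O.
Proof. exact/upset_leP. Qed.

HB.instance Definition _ := Order.hasBottom.Build upset_display (upset P) up_le0x.
HB.instance Definition _ := Order.hasTop.Build upset_display (upset P) up_lex1.

(** The Kripke semantics of implication. *)
Definition up_himpl U V : upset P :=
  @Upset _ P [set x | forall y, (x <= y)%O -> U y -> V y]
    (fun x y xy h z yz => h z (le_trans xy yz)).

Lemma up_himplP U V W : (W <= up_himpl U V)%O = (Order.meet W U <= V)%O.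
Proof.
apply/upset_leP/upset_leP => h x.
  by move=> [Wx Ux]; apply: (h x).
by move=> Wx y xy Uy; apply: h; split=> //; apply: upsetP Wx.
Qed.

Definition up_bigmeet (A : set (upset P)) : upset P :=
  @Upset _ P (\bigcap_(U in A) upset_set U) (fun x y xy h U AU => upsetP xy (h U AU)).

Lemma up_bigmeetP (A : set (upset P)) : infimums A (up_bigmeet A).
Proof.
split=> [U AU|V hV]; apply/upset_leP => x.
  exact.
by move=> Vx U /hV /upset_leP; apply.
Qed.

HB.instance Definition _ :=
  isLocale.Build upset_display (upset P) up_himplP up_bigmeetP.

Definition copoint y : upset P := @Upset _ P [set x | ~ (x <= y)%O]
  (fun x z xz nxy zy => nxy (le_trans xz zy)).

Lemma le_copoint U y : (U <= copoint y)%O <-> ~ U y.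
Proof.
split=> [/upset_leP h /h|nUy]; first exact.
by apply/upset_leP => x Ux xy; apply/nUy/upsetP/Ux.
Qed.

(** One of the two factors misses [y], and [copoint y] is the largest upset missing [y]. *)
Lemma copoint_prime y U V : copoint y = Order.meet U V -> copoint y = U \/ copoint y = V.
Proof.
move=> e; have : ~ (Order.meet U V) y by rewrite -e /= => /(_ (lexx y)).
have leU : (copoint y <= U)%O by rewrite e leIl.
have leV : (copoint y <= V)%O by rewrite e leIr.
move/not_andP => [] h; [left|right];
  by apply/le_anti/andP; split=> //; apply/le_copoint.
Qed.

(** * Sublocales induced by subspaces, and their supplements and closures *)

Section Spatial.
Implicit Type Y : set P.

Lemma spatial_subproof Y : is_sublocale
  [set U : upset P | forall x, ~ U x -> exists y, [/\ Y y, ~ U y & (x <= y)%O]].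
Proof.
split=> [A AY x|V U hU x].
  move=> /existsNP[U /not_implyP[AU nUx]].
  have [y [Yy nUy xy]] := AY _ AU _ nUx.
  by exists y; split=> // /(_ U AU).
move=> /existsNP[z /not_implyP[xz /not_implyP[Vz nUz]]].
have [y [Yy nUy zy]] := hU _ nUz.
exists y; split=> //; last exact: le_trans zy.
by move=> /(_ y (lexx y) (upsetP zy Vz)).
Qed.
(* The sublocale induced by the subspace [Y]: the meets of copoints of members
   of [Y]. *)
Definition spatial Y : sublocale (upset P) := Sublocale (spatial_subproof Y).

Lemma spatial_copoint Y y : sublocale_set (spatial Y) (copoint y) <-> Y y.
Proof.
split=> [/(_ y) []|Yy x /contrapT xy]; first by move/(_ (lexx y)).
  move=> z [Yz /contrapT zy yz].
  by have -> : y = z by apply/le_anti/andP.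
by exists y; split=> //; apply.
Qed.

(** The two sides cover everything because each copoint lies in one of them: [U] is the meet of the
    least members of [S] and of [T] above it. Conversely, copoints are prime, so any [T] whose join
    with [S] is everything contains each copoint outside [S], hence all meets of these. *)
Lemma sl_suppl_spatialE (S : sublocale (upset P)) :
  sl_suppl S = spatial [set y | ~ sublocale_set S (copoint y)].
Proof.
apply: sublocale_eqP.
  apply: (sl_supplP S).2; apply: sl_join_setT => U.
  set T := spatial _.
  exists (bigmeet [set s | sublocale_set S s /\ (U <= s)%O]),
    (bigmeet [set t | sublocale_set T t /\ (U <= t)%O]).
  split; [by apply: (sublocaleP S).1 => ? [] | by apply: (sublocaleP T).1 => ? [] |].
  apply/le_anti/andP; split.
    by rewrite lexI; apply/andP; split; apply: bigmeet_glb => ? [].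
  have above R x : sublocale_set R (copoint x) -> ~ upset_set U x ->
      ~ upset_set (bigmeet [set r | sublocale_set R r /\ (U <= r)%O]) x.
    by move=> Rx /le_copoint Ux; apply/le_copoint/bigmeet_lb.
  apply/upset_leP => x [xs xt]; apply: contrapT => nUx.
  have [Sx|nSx] := pselect (sublocale_set S (copoint x)); first exact: above xs.
  by apply: above xt => //; apply/spatial_copoint.
move=> U hU T hT.
have TU y : ~ sublocale_set S (copoint y) -> sublocale_set T (copoint y).
  have [s [t [Ss Tt e]]] := sl_join_setTP (copoint y) hT.
  by case: (copoint_prime e) => ->.
have -> : U =
    bigmeet [set copoint y | y in [set y | ~ sublocale_set S (copoint y) /\ ~ U y]].
  apply/le_anti/andP; split.
    by apply: bigmeet_glb => _ [y [_ nUy] <-]; apply/le_copoint.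
  apply/upset_leP => x xm; apply: contrapT => /hU [y [nSy nUy xy]].
  suff : upset_set (copoint y) x by exact.
  by move: {xy} x xm; apply/upset_leP/bigmeet_lb; exists y.
by apply: (sublocaleP T).1 => _ [y [nSy _] <-]; apply: TU.
Qed.

Lemma sl_suppl_spatial Y : sl_suppl (spatial Y) = spatial (~` Y).
Proof.
rewrite sl_suppl_spatialE; congr spatial; apply/seteqP.
by split=> y /= h; [move=> Yy; apply: h | move=> h'; apply: h]; apply/spatial_copoint.
Qed.

Lemma sl_closure_spatial Y :
  sl_closure (spatial Y) = spatial [set x | exists2 y, Y y & (x <= y)%O].
Proof.
rewrite sl_closureE; apply: sublocale_eqP => U hU.
  move=> x nUx; exists x; split=> //.
  have /existsNP[V /not_implyP[VY nVx]] : ~ (bigmeet (spatial Y) : upset P) x.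
    by move=> h; apply: nUx; move/upset_leP: hU; apply.
  by have [y [Yy _ xy]] := VY _ nVx; exists y.
apply/upset_leP => x xm; apply: contrapT => /hU [z [[y Yy zy] _ xz]].
have /upset_leP/(_ x xm) : (bigmeet (spatial Y) <= copoint y)%O.
  by apply: bigmeet_lb; apply/spatial_copoint.
by apply; apply: le_trans zy.
Qed.

Lemma spatial_setT U : sublocale_set (spatial setT) U.
Proof. by move=> x nUx; exists x; split. Qed.

End Spatial.
End UpsetLocale.

(** * The double-negation sublocale, in general and over [nat] *)

Section DoubleNegation.
Context {d : Order.disp_t} (L : localeType d).

Lemma booleanization_subproof : is_sublocale (range (fun x : L => himpl x \bot%O)).
Proof.
split=> [A sA|a _ [x _ <-]]; last by exists (Order.meet a x); rewrite ?himpl_curry.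
(* The members are the fixed points of double negation, so the meet is exhibited as the negation of
   its own negation. *)
exists (himpl (bigmeet A) \bot%O) => //; apply/le_anti/andP; split.
  apply: bigmeet_glb => y Ay; have [x _ yE] := sA _ Ay.
  rewrite -yE himplP; apply: le_trans (mp_himpl (himpl (bigmeet A) \bot%O) _).
  rewrite leI2 // himplP meetC -himplP yE; exact: bigmeet_lb.
by rewrite himplP meetC mp_himpl.
Qed.
Definition booleanization : sublocale L := Sublocale booleanization_subproof.

Lemma booleanization_bot : sublocale_set booleanization \bot%O.
Proof. by exists \top%O => //; apply/eqP; rewrite -lex0 -[leLHS]meetx1 mp_himpl. Qed.

End DoubleNegation.

(** Any two nonempty upsets of [nat] meet, so a pseudocomplement is empty or everything, while a
    copoint is neither. *)
Lemma booleanization_nat_copoint (n : nat) :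
  ~ sublocale_set (booleanization (upset nat)) (copoint n).
Proof.
move=> [U _ e].
have nU m : ~ U m.
  move=> Um; have : copoint n (maxn m n.+1).
    by rewrite /= leEnat => h; move: (leq_trans (leq_maxr m n.+1) h); rewrite ltnn.
  by rewrite -e => /(_ _ (lexx _)); apply; apply: upsetP Um; rewrite leEnat leq_maxl.
have : copoint n n by rewrite -e => m _ /nU.
by move=> /(_ (lexx n)).
Qed.

Lemma sl_suppl_booleanization_nat :
  sl_suppl (booleanization (upset nat)) = spatial setT.
Proof.
rewrite sl_suppl_spatialE; congr spatial; apply/seteqP; split=> // n _.
exact: booleanization_nat_copoint.
Qed.

Lemma sl_closure_booleanization_nat :
  sl_closure (booleanization (upset nat)) = spatial setT.
Proof.
rewrite sl_closureE; apply: sublocale_eqP => U _; first exact: spatial_setT.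
exact: le_trans (bigmeet_lb (booleanization_bot _)) (le0x U).
Qed.

(** * The model over [nat] *)

Definition parity_set (m : bool * bool) : set nat := [set n | if odd n then m.2 else m.1].

(* [None] stands for the double-negation sublocale. *)
Definition nat_model (m : option (bool * bool)) : sublocale (upset nat) :=
  if m is Some p then spatial (parity_set p) else booleanization (upset nat).
Definition nat_C (m : option (bool * bool)) :=
  if m is Some p then Some (p.1 || p.2, p.1 || p.2) else Some (true, true).
Definition nat_N (m : option (bool * bool)) :=
  if m is Some p then Some (~~ p.1, ~~ p.2) else Some (true, true).

Lemma parity_setT : parity_set (true, true) = setT.
Proof. by apply/seteqP; split=> // n _; rewrite /parity_set /= if_same. Qed.

(** Both parity classes are cofinal, as [n.*2] and [n.*2.+1] bound [n]; hence every nonempty parity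
    set has all of [nat] as its downset. *)
Lemma nat_modelC m : sl_closure (nat_model m) = nat_model (nat_C m).
Proof.
case: m => [[a b]|] /=; last by rewrite sl_closure_booleanization_nat parity_setT.
rewrite sl_closure_spatial; congr spatial; apply/seteqP; split=> n.
  by move=> [k hk _]; move: hk; rewrite /parity_set /=;
    case: a b (odd k) (odd n) => [] [] [] [].
rewrite /parity_set /= if_same => /orP[] h.
  by exists n.*2; rewrite /= ?odd_double // leEnat -addnn leq_addr.
by exists n.*2.+1; rewrite /= ?odd_double // leEnat -addnn -addnS leq_addr.
Qed.

Lemma nat_modelN m : sl_suppl (nat_model m) = nat_model (nat_N m).
Proof.
case: m => [[a b]|] /=; last by rewrite sl_suppl_booleanization_nat parity_setT.
rewrite sl_suppl_spatial; congr spatial; apply/seteqP.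
by split=> n; rewrite /parity_set /=; case: (odd n) a b => [] [] [].
Qed.

(** Containing the bottom amounts to being dense. *)
Definition nat_has_bot (m : option (bool * bool)) :=
  if m is Some p then p.1 || p.2 else true.
(** The point 1 is a sample odd number; its copoint tells the double-negation sublocale, which has
    no copoints, from the spatial ones that contain the odd numbers. *)
Definition nat_has_copoint1 (m : option (bool * bool)) :=
  if m is Some p then p.2 else false.

Lemma nat_model_bot m : sublocale_set (nat_model m) \bot%O <-> nat_has_bot m.
Proof.
case: m => [[a b]|] /=; last by split=> // _; apply: booleanization_bot.
split=> [/(_ 0 id) [k []]|]; first by rewrite /parity_set /=; case: a b (odd k) => [] [] [].
move=> /orP[] h n _.
  by exists n.*2; rewrite /parity_set /= odd_double; split=> //;
    rewrite leEnat -addnn leq_addr.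
by exists n.*2.+1; rewrite /parity_set /= odd_double; split=> //;
    rewrite leEnat -addnn -addnS leq_addr.
Qed.

Lemma nat_model_copoint1 m : sublocale_set (nat_model m) (copoint 1%N) <->
  nat_has_copoint1 m.
Proof.
case: m => [p|] /=; first exact: spatial_copoint.
by split=> // /booleanization_nat_copoint.
Qed.

(** * The model over the fork *)

Definition fork : Type := option bool.

HB.instance Definition _ := Choice.on fork.

(** [None] is the bottom and the two values [Some b] are the maximal points. *)
Definition fork_le (x y : fork) : bool := (x == None) || (x == y).

Lemma fork_le_refl : reflexive fork_le.
Proof. by move=> x; rewrite /fork_le eqxx orbT. Qed.
Lemma fork_le_anti : antisymmetric fork_le.
Proof. by move=> [[]|] [[]|]. Qed.
Lemma fork_le_trans : transitive fork_le.
Proof. by move=> [[]|] [[]|] [[]|]. Qed.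

HB.instance Definition _ := Order.Le_isPOrder.Build upset_display fork
  fork_le_refl fork_le_anti fork_le_trans.

Definition fork_model (f : fork -> bool) : sublocale (upset fork) :=
  spatial [set x | f x].
(** This is the downset: only the bottom can be a new point. *)
Definition fork_C (f : fork -> bool) (x : fork) : bool :=
  f x || (x == None) && (f (Some true) || f (Some false)).
Definition fork_N (f : fork -> bool) (x : fork) : bool := ~~ f x.

Lemma fork_modelC f : sl_closure (fork_model f) = fork_model (fork_C f).
Proof.
rewrite sl_closure_spatial; congr spatial; apply/seteqP; rewrite /fork_C; split=> x /=.
  move=> [y fy /orP[/eqP->|/eqP->]]; last by rewrite fy.
  by case: y fy => [[]|] ->; rewrite ?orbT.
move=> /orP[fx|/andP[/eqP-> /orP[]fy]].
- by exists x.
- by exists (Some true).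
- by exists (Some false).
Qed.

Lemma fork_modelN f : sl_suppl (fork_model f) = fork_model (fork_N f).
Proof.
rewrite sl_suppl_spatial; congr spatial; apply/seteqP.
by split=> x /negP.
Qed.

(* The tests were selected by a computer search: together they refute every
   inclusion missing from the diagram. *)
Definition hasse_tests (o : operator) : seq bool :=
  let sub (b0 b1 b2 : bool) (x : fork) :=
    match x with None => b0 | Some true => b1 | Some false => b2 end in
  [:: nat_has_bot (word nat_C nat_N o None);
      nat_has_copoint1 (word nat_C nat_N o (Some (true, false)));
      word fork_C fork_N o (sub false false true) (Some false);
      word fork_C fork_N o (sub true false false) None;
      word fork_C fork_N o (sub false false false) None;
      word fork_C fork_N o (sub false false true) None;
      word fork_C fork_N o (sub false true true) None].

(** * Completeness of the diagram, by membership tests *)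

Lemma word_test_imply o1 o2 d (L : localeType d) M (C N : M -> M)
    (r : M -> sublocale L) (x : L) (t : M -> bool) m :
  (forall m, sl_closure (r m) = r (C m)) ->
  (forall m, sl_suppl (r m) = r (N m)) ->
  (forall m, sublocale_set (r m) x <-> t m) ->
  (forall S : sublocale L, interp o1 S `<=` interp o2 S) ->
  t (word C N o1 m) ==> t (word C N o2 m).
Proof.
move=> rC rN rt sub; apply/implyP => /rt.
by rewrite -interp_word// => /sub; rewrite (interp_word _ _ rC rN) => /rt.
Qed.

Lemma hasse_tests_imply o1 o2 :
  (forall (d : Order.disp_t) (L : localeType d) (S : sublocale L),
     interp o1 S `<=` interp o2 S) ->
  all2 implb (hasse_tests o1) (hasse_tests o2).
Proof.
move=> h.
have fork_test f y : word fork_C fork_N o1 f y ==> word fork_C fork_N o2 f y.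
  apply: (word_test_imply (x := copoint y) (t := fun g => g y) _
    fork_modelC fork_modelN _ (h _ _)) => g.
  exact: spatial_copoint.
apply/andP; split; last (apply/andP; split;
  last by do 5!(apply/andP; split; first exact: fork_test)).
- exact: word_test_imply nat_modelC nat_modelN nat_model_bot (h _ _).
- exact: word_test_imply nat_modelC nat_modelN nat_model_copoint1 (h _ _).
Qed.

Ltac hasse_step o := apply: (@rt_trans _ _ _ o); [apply: rt_step; exact: I |].
(** Backtracking search for a path, which terminates since the diagram is acyclic. The candidates
    for the next vertex are the operators with an incoming edge; [o_i] and [o_nc], the least
    elements of the two components, have none. *)
Ltac hasse_search :=
  solve [ apply: rt_refl
    | hasse_step o_c; hasse_search | hasse_step o_cnn; hasse_search
    | hasse_step o_cic; hasse_search | hasse_step o_cicnn; hasse_search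
    | hasse_step o_ci; hasse_search | hasse_step o_ic; hasse_search
    | hasse_step o_icnn; hasse_search | hasse_step o_ici; hasse_search
    | hasse_step o_nn; hasse_search | hasse_step o_id; hasse_search
    | hasse_step o_ni; hasse_search | hasse_step o_n; hasse_search
    | hasse_step o_nici; hasse_search | hasse_step o_cin; hasse_search
    | hasse_step o_nci; hasse_search | hasse_step o_nic; hasse_search
    | hasse_step o_icin; hasse_search | hasse_step o_in; hasse_search
    | hasse_step o_ncic; hasse_search ].

(** A finite check over all pairs of operators: either some test computes to a refutation, or a path
    is found. *)
Lemma hasse_tests_complete o1 o2 :
  all2 implb (hasse_tests o1) (hasse_tests o2) -> hasse_le o1 o2.
Proof. case: o1; case: o2; (by []) || (move=> _; hasse_search). Qed.

Theorem theorem3 (o1 o2 : operator) :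
  (forall (d : Order.disp_t) (L : localeType d) (S : sublocale L),
     interp o1 S `<=` interp o2 S)
  <-> hasse_le o1 o2.
Proof.
split=> [h|le12 d L S]; first exact/hasse_tests_complete/hasse_tests_imply.
exact: hasse_le_sound.
Qed.
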